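(* Let $X\in\mathbb R^{n\times p}$ be fixed, let $\mathbf y\in\mathbb R^n$ be a random vector with independent components satisfying, for some $\sigma\ge0$, $\mathbb E\,e^{t(\mathbf y_i-\mathbb E\mathbf y_i)}\le e^{\sigma^2t^2/2}$ for all $i$ and all $t\in\mathbb R$, and let $\hat Q(\beta)=\|X\beta-\mathbf y\|_2^2$. Let $\mathrm{cl}$ be a coding length with coding complexity $c(\cdot)$. For $\lambda>0$ let $\hat\beta_{pen}$ be a minimizer over $\beta\in\mathbb R^p$ of $\hat Q(\beta)+\lambda c(\beta)$. Fix a target $\bar\beta\in\mathbb R^p$ and $\eta\in(0,1)$. Then with probability exceeding $1-\eta$, for all $\lambda>7.4\sigma^2$ and all $a\ge 7.4\sigma^2/(\lambda-7.4\sigma^2)$, \[ \|X\hat\beta_{pen}-\mathbb E\mathbf y\|_2^2\le(1+a)^2\|X\bar\beta-\mathbb E\mathbf y\|_2^2+(1+a)\lambda c(\bar\beta)+\sigma^2(10+5a+7a^{-1})\ln(6/\eta). \]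
   Context: Let $\mathcal I=\{1,\ldots,p\}$ and $\mathrm{supp}(\beta)=\{j:\beta_j\ne0\}$. A function $\mathrm{cl}$ from subsets of $\mathcal I$ to $[0,\infty]$ is a coding length if $\sum_{F\subset\mathcal I,\,F\ne\emptyset}2^{-\mathrm{cl}(F)}\le1$, with $\mathrm{cl}(\emptyset)=0$. The coding complexity is $c(F)=|F|+\mathrm{cl}(F)$ for $F\subset\mathcal I$, and $c(\beta)=\min\{c(F):\mathrm{supp}(\beta)\subset F\}$ for $\beta\in\mathbb R^p$. *)

(* Defs.v *)
From HB Require Import structures.
From mathcomp Require Import all_boot all_order all_algebra.
From mathcomp Require Import all_classical all_reals all_analysis.
Set Implicit Arguments. Unset Strict Implicit. Unset Printing Implicit Defensive.
Import Order.TTheory GRing.Theory Num.Theory.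
Local Open Scope ring_scope.

Definition supp (R : realType) (p : nat) (beta : 'cV[R]_p) : {set 'I_p} :=
  [set j | beta j ord0 != 0].

Definition pow2neg (R : realType) (x : \bar R) : R :=
  match x with
  | EFin r => expR (- r * ln 2)
  | +oo%E => 0
  | -oo%E => 0 (* never used: coding lengths are nonnegative *)
  end.

Definition coding_length (R : realType) (p : nat) (cl : {set 'I_p} -> \bar R) : Prop :=
  [/\ cl finset.set0 = 0%E,
      (forall F, (0 <= cl F)%E) &
      \sum_(F : {set 'I_p} | F != finset.set0) pow2neg (cl F) <= 1].

Definition ccF (R : realType) (p : nat) (cl : {set 'I_p} -> \bar R) (F : {set 'I_p}) : \bar R :=
  ((#|F|%:R : R)%:E + cl F)%E.

Definition ccomp (R : realType) (p : nat) (cl : {set 'I_p} -> \bar R) (beta : 'cV[R]_p) : \bar R :=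
  \big[mine/+oo%E]_(F : {set 'I_p} | supp beta \subset F) ccF cl F.

Definition sqnorm (R : realType) (n : nat) (v : 'cV[R]_n) : R :=
  \sum_(i < n) v i ord0 ^+ 2.

Definition mutually_independent d (T : measurableType d) (R : realType)
  (P : probability T R) (n : nat) (y : 'I_n -> T -> R) : Prop :=
  forall B : 'I_n -> set R, (forall i, measurable (B i)) ->
    P (\bigcap_(i in [set: 'I_n]) (y i @^-1` B i))%classic
    = (\prod_(i < n) P (y i @^-1` B i)%classic)%E.

Definition mean d (T : measurableType d) (R : realType) (P : probability T R)
  (f : T -> R) : R := fine (\int[P]_x (f x)%:E)%E.

(* Main.v *)
(** Write [y = f + e] with [f = E y].  Comparing the penalized criterion at the
    minimizer and at the target leaves the cross term [2 <X betahat - f, e>].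
    If [F] attains the complexity of [betahat], the vector [X betahat - f] lies
    in the span of [f], [X betabar] and the columns of [X] indexed by [F], so
    AM-GM reduces the cross term to the energy [N_F] of the projection of [e]
    on this space of dimension at most [|F| + 2].  A Gaussian mixture turns
    [exp (N_F)] into an average of exponentials of linear forms in [e], and the
    sub-Gaussian hypothesis gives [P (N_F > sigma^2 t) <= 2^(|F|+2) e^(-3t/8)].
    The coding length makes these probabilities, at the level
    [t = 7.4 c(F) + (10/3) ln (6/eta)], sum to less than [eta]. *)

Require Import Defs.
From HB Require Import structures.
From mathcomp Require Import all_boot all_order all_algebra.
From mathcomp Require Import all_classical all_reals all_analysis.
From mathcomp Require Import measurable_realfun ring lra.
Import Order.TTheory GRing.Theory Num.Theory.
Local Open Scope ring_scope.
Set Implicit Arguments. Unset Strict Implicit. Unset Printing Implicit Defensive.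

(** * Expectation of products of independent variables *)

Section change_of_variable.
Import HBNNSimple.

(** Domination tested on indicators of [Y] passes to simple functions by linearity, then to [f] by
    monotone convergence. It serves to replace one indicator factor of a product by a general
    one. *)
Lemma le_integral_mul_comp d (T : measurableType d) (R : realType)
  (P : {measure set T -> \bar R}) (h Y : T -> R) (c : R) (f : R -> R) :
  measurable_fun setT h -> (forall x, 0 <= h x) -> measurable_fun setT Y ->
  0 <= c ->
  (forall B, measurable B ->
     (\int[P]_x (h x * \1_B (Y x))%:E <= c%:E * P (Y @^-1` B)%classic)%E) ->
  measurable_fun setT f -> (forall t, 0 <= f t) ->
  (\int[P]_x (h x * f (Y x))%:E <= c%:E * \int[P]_x (f (Y x))%:E)%E.
Proof.
move=> mh h0 mY c0 hB mf f0.
have mf' := (measurable_EFinP _ _).2 mf.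
pose g := nnsfun_approx measurableT mf'.
have g0 n t : 0 <= g n t by [].
have nd_g t : {homo g^~ t : m n / (m <= n)%N >-> m <= n}.
  by move=> m n mn; exact/lefP/nd_nnsfun_approx.
have g_cvg t : ((g n t)%:E @[n --> \oo] --> (f t)%:E)%classic.
  by apply: cvg_nnsfun_approx => // x _; rewrite lee_fin.
have mg n : measurable_fun setT (fun x => g n (Y x)).
  by apply: measurableT_comp => //.
have g_le_f n t : g n t <= f t.
  rewrite -lee_fin -(cvg_lim _ (g_cvg t))//.
  apply: lime_ge; first by apply/cvg_ex; exists (f t)%:E.
  by exists n => // m /= nm; rewrite lee_fin nd_g.
have simple n : (\int[P]_x (h x * g n (Y x))%:E <= c%:E * \int[P]_x (g n (Y x))%:E)%E.
  pose A r := (g n @^-1` [set r])%classic.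
  have mA r : measurable (A r) by exact: measurable_sfunP.
  have [s gE] : exists s : seq R, forall t, g n t = \sum_(r <- s) r * \1_(A r) t.
    by eexists => t; rewrite fimfunE fsbig_finite.
  have rA0 r t : 0 <= r * \1_(A r) t.
    by have := nnfun_muleindic_ge0 (g n) r t; rewrite -EFinM lee_fin.
  have mrA r : measurable_fun setT (fun x => r * \1_(A r) (Y x)).
    by apply: measurable_funM => //; apply: measurableT_comp.
  under eq_integral => x _ do rewrite gE mulr_sumr -sumEFin.
  under [X in (_ <= _ * X)%E]eq_integral => x _ do rewrite gE -sumEFin.
  rewrite !ge0_integral_sum//; last 4 first.
  - by move=> r; apply/measurable_EFinP.
  - by move=> r x _; rewrite lee_fin.
  - by move=> r; apply/measurable_EFinP; apply: measurable_funM.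
  - by move=> r x _; rewrite lee_fin mulr_ge0.
  rewrite ge0_sume_distrr => [|r _]; last by apply: integral_ge0 => x _; rewrite lee_fin.
  apply: lee_sum => r _.
  (* The nonnegative [g n] takes no negative value, so the indicator for such an [r] vanishes. *)
  have [r0|r0] := leP 0 r; last first.
    have A0 t : \1_(A r) t = 0 :> R.
      by have := rA0 r t; rewrite indicE; case: (_ \in _) => //; rewrite mulr1 leNgt r0.
    by rewrite !integral0_eq ?mule0// => x _; rewrite A0 !mulr0.
  under eq_integral => x _ do rewrite mulrCA EFinM.
  rewrite ge0_integralZl_EFin//; last 2 first.
  - by move=> x _; rewrite lee_fin mulr_ge0.
  - apply/measurable_EFinP; apply: measurable_funM => //.
    by apply: measurableT_comp.
  under [X in (_ <= _ * X)%E]eq_integral => x _ do rewrite EFinM.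
  rewrite ge0_integralZl_EFin//; last by apply/measurable_EFinP; apply: measurableT_comp.
  rewrite muleCA; apply: lee_wpmul2l; first by rewrite lee_fin.
  apply: (le_trans (hB _ (mA r))).
  rewrite (integral_indic _ measurableT (A := (Y @^-1` A r)%classic)) ?setIT//.
  by rewrite -[X in measurable X]setTI; exact: mY.
have mono : (\int[P]_x (h x * g n (Y x))%:E @[n --> \oo] -->
    \int[P]_x (h x * f (Y x))%:E)%E%classic.
  rewrite [X in (_ --> X)%classic](_ : _ = \int[P]_x limn (fun n => (h x * g n (Y x))%:E))%E.
    apply: (@cvg_monotone_convergence _ _ _ _ _ _ (fun n x => (h x * g n (Y x))%:E)) => //.
    - by move=> n; apply/measurable_EFinP; apply: measurable_funM.
    - by move=> n x _; rewrite lee_fin mulr_ge0.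
    - by move=> x _ m n mn; rewrite lee_fin ler_wpM2l// nd_g.
  apply: eq_integral => x _; apply/esym/cvg_lim => //.
  by rewrite EFinM; under eq_fun do rewrite EFinM; apply: cvgeZl.
apply: (cvge_to_le mono); apply: nearW => n.
apply: (le_trans (simple n)); apply: lee_wpmul2l; first by rewrite lee_fin.
apply: ge0_le_integral => //; try by move=> x _; rewrite lee_fin.
- exact/measurable_EFinP.
- by apply/measurable_EFinP; apply: measurableT_comp.
Qed.

End change_of_variable.

Lemma measurable_proj_prod d (T : measurableType d) (R : realType) (n : nat)
  (y : 'I_n -> T -> R) (f : 'I_n -> R -> R) (Q : pred 'I_n) :
  (forall i, measurable_fun setT (y i)) ->
  (forall i, measurable_fun setT (f i)) ->
  measurable_fun setT (fun x => \prod_(i | Q i) f i (y i x)).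
Proof.
move=> my mf; 
rewrite (_ : (fun x => _) = (fun x => \prod_i (if Q i then f i (y i x) else 1))); last first.
  by apply/funext => x; rewrite [LHS]big_mkcond.
apply: measurable_prod => i _; case: (Q i) => //.
by apply: measurableT_comp.
Qed.

(** Independence is a statement about sets, so the bound is reached by exchanging indicators for
    general factors one at a time. *)
Lemma independent_expectation_prod_le d (T : measurableType d) (R : realType)
  (P : probability T R) (n : nat) (y : 'I_n -> T -> R)
  (f : 'I_n -> R -> R) (c : 'I_n -> R) :
  mutually_independent P y ->
  (forall i, measurable_fun setT (y i)) ->
  (forall i, measurable_fun setT (f i)) ->
  (forall i t, 0 <= f i t) ->
  (forall i, \int[P]_x (f i (y i x))%:E <= (c i)%:E)%E ->
  (\int[P]_x (\prod_(i < n) f i (y i x))%:E <= (\prod_(i < n) c i)%:E)%E.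
Proof.
move=> ind my mf f0 fc.
(* Factors of index at least [k] are indicators: [k = 0] is independence itself and [k = n] the
   claim. *)
suff {f c mf f0 fc} step k : forall (f : 'I_n -> R -> R) (c : 'I_n -> R),
    (forall i, measurable_fun setT (f i)) -> (forall i t, 0 <= f i t) ->
    (forall i, \int[P]_x (f i (y i x))%:E <= (c i)%:E)%E ->
    (forall i : 'I_n, (k <= i)%N -> exists2 B, measurable B & f i = \1_B) ->
    (\int[P]_x (\prod_(i < n) f i (y i x))%:E <= (\prod_(i < n) c i)%:E)%E.
  by apply: (step n) => // i; rewrite leqNgt ltn_ord.
have c_ge0 (f : 'I_n -> R -> R) (c : 'I_n -> R) : (forall i t, 0 <= f i t) ->
    (forall i, \int[P]_x (f i (y i x))%:E <= (c i)%:E)%E -> forall i, 0 <= c i.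
  move=> f0 fc i; rewrite -lee_fin; apply: le_trans (fc i).
  by apply: integral_ge0 => x _; rewrite lee_fin.
have int_indic i B : measurable B ->
    (\int[P]_x (\1_B (y i x))%:E = P (y i @^-1` B)%classic)%E.
  move=> mB; rewrite (integral_indic _ measurableT (A := (y i @^-1` B)%classic)) ?setIT//.
  by rewrite -[X in measurable X]setTI; exact: my.
elim: k => [|k IH] f c mf f0 fc fB.
  have /choice[B BP] : forall i, exists B, measurable B /\ f i = \1_B.
    by move=> i; have [//|B mB ->] := fB i; exists B.
  have mB i : measurable (B i) by case: (BP i).
  have fE i : f i = \1_(B i) by case: (BP i).
  under eq_integral => x _.
    have -> : \prod_(i < n) f i (y i x) =
       \1_(\bigcap_(i in [set: 'I_n]) (y i @^-1` B i))%classic x.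
      under eq_bigr => i _ do rewrite fE.
      rewrite [RHS]indicE; case: (pselect (forall i, B i (y i x))) => h.
        rewrite mem_set; last by move=> i _; exact: h.
        by rewrite big1// => i _; rewrite indicE mem_set.
      have [i Bi] := (existsNP _).2 h.
      have Bi' : (y i x \in B i) = false by exact: memNset.
      rewrite (bigD1 i)// indicE Bi' mulr0n [LHS]mul0r.
      by rewrite memNset // => /(_ i Logic.I).
    over.
  rewrite integral_indic//; last first.
    apply: fin_bigcap_measurable => // i _.
    by rewrite -[X in measurable X]setTI; exact: my.
  have mY i : measurable (y i @^-1` B i)%classic.
    by rewrite -[X in measurable X]setTI; exact: my.
  have PE i : P (y i @^-1` B i)%classic = (fine (P (y i @^-1` B i)%classic))%:E.
    by rewrite fineK// fin_num_measure.
  rewrite setIT [X in (X <= _)%E](ind B mB).   under eq_bigr => i _ do rewrite PE.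
  rewrite prodEFin lee_fin; apply: ler_prod => i _; apply/andP; split.
    by rewrite fine_ge0.
  by rewrite -lee_fin -PE -int_indic// -fE.
have [nk|kn] := leqP n k.
  apply: IH => // i ki; have := ltn_ord i; by rewrite ltnNge (leq_trans nk).
pose j := Ordinal kn.
under eq_integral => x _ do rewrite (bigD1 j)//= mulrC.
rewrite (bigD1 j)//= mulrC.
apply: (@le_trans _ _ ((\prod_(i < n | i != j) c i)%:E * \int[P]_x (f j (y j x))%:E)%E); last first.
  rewrite EFinM; apply: lee_wpmul2l => //.
  by rewrite lee_fin prodr_ge0// => i _; exact: (c_ge0 f).
apply: (@le_integral_mul_comp _ _ _ P (fun x => \prod_(i < n | i != j) f i (y i x))) => //.
- exact: measurable_proj_prod.
- by move=> x; apply: prodr_ge0.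
- by apply: prodr_ge0 => i _; exact: (c_ge0 f).
move=> B mB.
(* With [\1_B] as factor [j], one fewer factor is arbitrary, and the induction hypothesis supplies
   the test on [B]. *)
pose f' i := if i == j then \1_B else f i.
pose c' i := if i == j then fine (P (y j @^-1` B)%classic) else c i.
have := IH f' c'; rewrite (bigD1 j)//=;
rewrite /c' eqxx.
have restE : \prod_(i < n | i != j) c' i = \prod_(i < n | i != j) c i.
  by apply: eq_bigr => i /negbTE ij; rewrite /c' ij.
have PfE : (fine (P (y j @^-1` B)%classic))%:E = P (y j @^-1` B)%classic.
  by rewrite fineK// fin_num_measure// -[X in measurable X]setTI; exact: my.
rewrite restE mulrC EFinM PfE => IH'.
apply: le_trans (IH' _ _ _ _).
- rewrite le_eqVlt; apply/orP; left; apply/eqP; apply: eq_integral => x _.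
  rewrite [in RHS](bigD1 j)//= /f' eqxx mulrC; congr (_ * _)%:E.
  by apply: eq_bigr => i /negbTE ->.
- by move=> i; rewrite /f'; case: eqP.
- by move=> i t; rewrite /f'; case: eqP => // _; rewrite indicE.
- by move=> i; rewrite /f' /c'; case: eqP => [->|//]; rewrite int_indic// PfE.
- move=> i ki; rewrite /f'; case: eqVneq => [_|ij]; first by exists B.
  by apply: fB; rewrite ltn_neqAle ki andbT; apply: contra_neq ij => ki'; apply/val_inj.
Qed.

(** * Exponential moments of projected noise *)

(** Completing the square gives a multiple of the normal density of mean [k ^+ 2 * b] and standard
    deviation [k]. The form [1 - k ^- 2] keeps the quadratic coefficient below 1 and the integral
    finite. *)
Lemma integral_normal_pdf_expR (R : realType) (b k : R) : 0 < k ->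
  (\int[lebesgue_measure]_g
      (normal_pdf 0 1 g * expR (b * g + (1 - k ^- 2) * g ^+ 2 / 2))%:E
   = (k * expR (k ^+ 2 * b ^+ 2 / 2))%:E)%E.
Proof.
move=> k0; have kN0 : k != 0 by rewrite gt_eqF.
have pdfE g : normal_pdf 0 1 g * expR (b * g + (1 - k ^- 2) * g ^+ 2 / 2) =
    k * expR (k ^+ 2 * b ^+ 2 / 2) * normal_pdf (k ^+ 2 * b) k g.
  rewrite !normal_pdfE ?oner_neq0// /normal_peak /normal_fun.
  rewrite expr1n mul1r -mulrnAr sqrtrM ?sqr_ge0// sqrtr_sqr gtr0_norm//.
  set s := (_ (pi *+ 2))^-1; set A := expR (k ^+ 2 * _ / 2); set B := expR (_ / (k ^+ 2 *+ 2)).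
  rewrite [X in _ * (X * B)]invfM -/s.
  have -> : k * A * (k^-1 * s * B) = s * (A * B) by field.
  rewrite -[LHS]mulrA -!expRD; congr (_ * expR _).
  by field.
under eq_integral => g _ do rewrite pdfE EFinM.
rewrite ge0_integralZl_EFin ?integral_normal_pdf ?mule1//.
- by move=> g _; rewrite lee_fin normal_pdf_ge0.
- by apply/measurable_EFinP; exact: measurable_normal_pdf.
- by rewrite mulr_ge0 ?expR_ge0// ltW.
Qed.

Definition dot (R : realType) (n : nat) (u v : 'cV[R]_n) : R :=
  \sum_(i < n) u i ord0 * v i ord0.

(** The exponential of a linear form is a product over coordinates, each bounded by the sub-Gaussian
    hypothesis at [t = v i ord0]. *)
Lemma subgaussian_dot d (T : measurableType d) (R : realType)
  (P : probability T R) (n : nat) (y : 'I_n -> T -> R) (sigma : R)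
  (m : 'I_n -> R) (v : 'cV[R]_n) :
  mutually_independent P y ->
  (forall i, measurable_fun setT (y i)) ->
  (forall i (t : R), (\int[P]_x (expR (t * (y i x - m i)))%:E
         <= (expR (sigma ^+ 2 * t ^+ 2 / 2))%:E)%E) ->
  (\int[P]_x (expR (dot v (\col_i (y i x - m i))))%:E
   <= (expR (sigma ^+ 2 * dot v v / 2))%:E)%E.
Proof.
move=> ind my sg.
under eq_integral => x _.
  rewrite /dot expR_sum; under eq_bigr => i _ do rewrite mxE.
  over.
rewrite [X in expR X](_ : _ = \sum_i sigma ^+ 2 * (v i ord0) ^+ 2 / 2); last first.
  by rewrite /dot mulr_sumr mulr_suml; apply: eq_bigr => i _; rewrite expr2.
rewrite expR_sum.
apply: (@independent_expectation_prod_le _ _ _ P _ y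
  (fun i t => expR (v i ord0 * (t - m i)))) => //.
- by move=> i; apply: measurableT_comp => //; apply: measurable_funM => //; apply: measurable_funB.
Qed.

Section dot_product.
Context {R : realType} {n : nat}.
Implicit Types (u v w : 'cV[R]_n) (us : seq 'cV[R]_n).

Lemma dotC u v : dot u v = dot v u.
Proof. by apply: eq_bigr => i _; rewrite mulrC. Qed.

Lemma dotDl u v w : dot (u + v) w = dot u w + dot v w.
Proof. by rewrite -big_split; apply: eq_bigr => i _; rewrite mxE mulrDl. Qed.

Lemma dotZl (a : R) u w : dot (a *: u) w = a * dot u w.
Proof. by rewrite mulr_sumr; apply: eq_bigr => i _; rewrite mxE mulrA. Qed.

Lemma dotDr u v w : dot w (u + v) = dot w u + dot w v.
Proof. by rewrite dotC dotDl ![dot _ w]dotC. Qed.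

Lemma dotZr (a : R) u w : dot w (a *: u) = a * dot w u.
Proof. by rewrite dotC dotZl dotC. Qed.

Lemma dot0l w : dot 0 w = 0.
Proof. by rewrite -(scale0r 0) dotZl mul0r. Qed.

Definition orthonormal us : bool :=
  all (fun u => dot u u == 1) us && pairwise (fun u v => dot u v == 0) us.

(** For an orthonormal [us], the squared norm of the projection of [w] on its span. *)
Definition energy us w : R := \sum_(u <- us) dot u w ^+ 2.

Lemma orthonormal_cons u us : orthonormal (u :: us) ->
  [/\ dot u u = 1, forall v, v \in us -> dot u v = 0 & orthonormal us].
Proof.
rewrite /orthonormal pairwise_cons /= => /andP[/andP[/eqP u1 us1]].
move=> /andP[/allP u0 us0]; split; rewrite ?us1 ?us0//.
by move=> v /u0/eqP.
Qed.

Lemma energy_ge0 us w : 0 <= energy us w.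
Proof. by apply: sumr_ge0 => u _; exact: sqr_ge0. Qed.

End dot_product.

Section noise.
Context d (T : measurableType d) (R : realType) (P : probability T R) (n : nat).
Variables (e : T -> 'cV[R]_n) (sigma : R).
Hypothesis me : forall i, measurable_fun setT (fun x => e x i ord0).
Hypothesis sg : forall v,
  (\int[P]_x (expR (dot v (e x)))%:E <= (expR (sigma ^+ 2 * dot v v / 2))%:E)%E.

Lemma measurable_dot v : measurable_fun setT (fun x => dot v (e x)).
Proof. by apply: measurable_sum => i; apply: measurable_funM. Qed.

Lemma measurable_energy us : measurable_fun setT (fun x => energy us (e x)).
Proof.
by apply: measurable_sum => u; apply: measurable_funX; exact: measurable_dot.
Qed.

(* The Gaussian identity exp(x^2/2) = E exp(g x) turns the exponential of a
   square into an average of exponentials of linear forms. *)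
Lemma integral_expR_energy_le (tau k : R) us v :
  0 < k -> 1 - k ^- 2 = sigma ^+ 2 * tau ^+ 2 -> orthonormal us ->
  (\int[P]_x (expR (dot v (e x) + tau ^+ 2 * energy us (e x) / 2))%:E
   <= (k ^+ size us *
       expR (sigma ^+ 2 * (dot v v + (k ^+ 2 - 1) * energy us v) / 2))%:E)%E.
Proof.
(* The linear term lets the induction close: removing the square along [u] shifts [v] by a multiple
   of [u]. *)
move=> k0 kE; elim: us v => [|u us IH] v.
  move=> _; rewrite expr0 mul1r /energy big_nil mulr0 addr0.
  by under eq_integral => x _ do rewrite big_nil mulr0 mul0r addr0.
move=> /orthonormal_cons[u1 u0 ous].
pose F (z : T * R) := normal_pdf 0 1 z.2 *
  expR (dot (v + (tau * z.2) *: u) (e z.1) + tau ^+ 2 * energy us (e z.1) / 2).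
have F0 z : 0 <= F z by rewrite mulr_ge0 ?expR_ge0 ?normal_pdf_ge0.
have mF : measurable_fun setT F.
  have mfst (f : T -> R) : measurable_fun setT f -> measurable_fun setT (fun z : T * R => f z.1).
    by move=> mf; apply: measurableT_comp.
  have msnd (f : R -> R) : measurable_fun setT f -> measurable_fun setT (fun z : T * R => f z.2).
    by move=> mf; apply: measurableT_comp.
  apply: measurable_funM; first exact: (msnd _ (measurable_normal_pdf 0 1)).
  apply: measurableT_comp => //; apply: measurable_funD; last first.
    apply: (mfst (fun x => tau ^+ 2 * energy us (e x) / 2)).
    apply: measurable_funM => //; apply: measurable_funM => //; exact: measurable_energy.
  under eq_fun => z do rewrite dotDl dotZl.
  apply: measurable_funD; first exact: (mfst _ (measurable_dot v)).
  apply: measurable_funM; last exact: (mfst _ (measurable_dot u)).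
  by apply: measurable_funM => //; exact: measurable_snd.
have mG (b c : R) : measurable_fun setT (fun g => normal_pdf 0 1 g *
    expR (b * g + c * g ^+ 2 / 2)).
  apply: measurable_funM; first exact: measurable_normal_pdf.
  apply: measurableT_comp => //; apply: measurable_funD; first exact: measurable_funM.
  by apply: measurable_funM => //; apply: measurable_funM => //; apply: measurable_funX.
have -> : (\int[P]_x (expR (dot v (e x) + tau ^+ 2 * energy (u :: us) (e x) / 2))%:E
    = \int[P]_x \int[lebesgue_measure]_g (F (x, g))%:E)%E.
  apply: eq_integral => x _.
  (* At [k = 1] the quadratic term vanishes, which leaves the Gaussian identity. *)
  have := @integral_normal_pdf_expR R (tau * dot u (e x)) 1 ltr01.
  rewrite expr1n invr1 subrr !mul1r => gauss.
  rewrite /energy big_cons -/(energy us (e x)).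
  rewrite mulrDr mulrDl addrCA expRD EFinM -exprMn -gauss muleC.
  rewrite -ge0_integralZl_EFin ?expR_ge0//; last 2 first.
  - by move=> g _; rewrite lee_fin mulr_ge0 ?expR_ge0 ?normal_pdf_ge0.
  - apply/measurable_EFinP; exact: mG.
  apply: eq_integral => g _; rewrite -EFinM /F/= dotDl dotZl mulrCA; congr (_ * _)%:E.
  by rewrite -expRD; congr expR; ring.
rewrite (@fubini_tonelli _ _ _ _ _ P lebesgue_measure (EFin \o F))//; last first.
  exact/measurable_EFinP.
set C := expR (sigma ^+ 2 * (dot v v + (k ^+ 2 - 1) * energy us v) / 2).
(* What depends on [g] after the induction hypothesis; the quadratic coefficient is
   [sigma ^+ 2 * tau ^+ 2 = 1 - k ^- 2]. *)
pose G g := normal_pdf 0 1 g *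
  expR ((sigma ^+ 2 * tau * dot u v) * g + (1 - k ^- 2) * g ^+ 2 / 2).
have G0 g : 0 <= G g by rewrite mulr_ge0 ?expR_ge0 ?normal_pdf_ge0.
have C0 : 0 <= k ^+ size us * C by rewrite mulr_ge0 ?expR_ge0 ?exprn_ge0 ?ltW.
apply: (@le_trans _ _ (\int[lebesgue_measure]_g (k ^+ size us * C * G g)%:E)%E).
  apply: ge0_le_integral => //.
  - by move=> g _; apply: integral_ge0 => x _; rewrite lee_fin.
  - by apply: (@measurable_fun_fubini_tonelli_G _ _ _ _ _ P (EFin \o F)) => //;
      exact/measurable_EFinP.
  - apply/measurable_EFinP; apply: measurable_funM => //.
    exact: (mG (sigma ^+ 2 * tau * dot u v)).
  move=> g _; rewrite /F/=; under eq_integral => x _ do rewrite EFinM.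
  rewrite ge0_integralZl_EFin ?normal_pdf_ge0//; last first.
    apply/measurable_EFinP; apply: measurableT_comp => //; apply: measurable_funD.
      exact: measurable_dot.
    by apply: measurable_funM => //; apply: measurable_funM => //; exact: measurable_energy.
  apply: le_trans (lee_wpmul2l _ (IH _ ous)) _; first by rewrite lee_fin normal_pdf_ge0.
  (* The shift is along [u], which is orthogonal to the remaining vectors. *)
  have -> : energy us (v + (tau * g) *: u) = energy us v.
    apply: eq_big_seq => w /u0; rewrite dotDr dotZr => dot0.
    by rewrite (dotC w u) dot0 mulr0 addr0.
  rewrite -EFinM lee_fin /G /C le_eqVlt; apply/orP; left; apply/eqP.
  rewrite [RHS]mulrACA -expRD [LHS]mulrCA mulrA; congr (_ * expR _).
  rewrite kE !(dotDl, dotDr, dotZl, dotZr) u1 (dotC v u).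
  by field.
under eq_integral => g _ do rewrite EFinM.
rewrite ge0_integralZl_EFin//; last 2 first.
- by move=> g _; rewrite lee_fin; exact: G0.
- apply/measurable_EFinP; exact: (mG (sigma ^+ 2 * tau * dot u v)).
rewrite integral_normal_pdf_expR// -EFinM lee_fin /C [size (u :: us)]/=.
rewrite (exprSr k (size us)) [leLHS]mulrACA -expRD.
rewrite le_eqVlt; apply/orP; left; apply/eqP; congr (_ * expR _).
rewrite /energy big_cons -/(energy us v).
have kE' : k ^+ 2 - 1 = k ^+ 2 * (sigma ^+ 2 * tau ^+ 2) by rewrite -kE; field; rewrite gt_eqF.
by rewrite kE'; field.
Qed.

Lemma measurable_energy_gt us (t : R) :
  measurable [set x | t < energy us (e x)]%classic.
Proof.
rewrite (_ : [set x | _]%classic = ((fun x => energy us (e x)) @^-1` `]t, +oo[)%classic).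
  by rewrite -[X in measurable X]setTI; apply: measurable_energy.
by apply/seteqP; split => x /=; rewrite in_itv/= andbT.
Qed.

(** Here [k] is the inverse square root of [1 - sigma ^+ 2 * tau ^+ 2], so the bound is the
    chi-square moment generating function with one degree of freedom per vector of [us]. *)
Lemma integral_expR_energy_le0 (tau k : R) us :
  0 < k -> 1 - k ^- 2 = sigma ^+ 2 * tau ^+ 2 -> orthonormal us ->
  (\int[P]_x (expR (tau ^+ 2 * energy us (e x) / 2))%:E <= (k ^+ size us)%:E)%E.
Proof.
move=> k0 kE ous; have := integral_expR_energy_le 0 k0 kE ous.
rewrite [energy us 0]big1_seq; last by move=> u _; rewrite dotC dot0l expr0n.
rewrite dot0l mulr0 addr0 mulr0 mul0r expR0 mulr1.
by under eq_integral => x _ do rewrite dot0l add0r.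
Qed.

(** Chernoff bound at [k = 2]: each dimension costs a factor 2, and [sigma ^+ 2 * tau ^+ 2 = 3 / 4]
    yields the rate [3 / 8]. *)
Lemma energy_gt_le us (t : R) : 0 <= sigma -> orthonormal us ->
  (P [set x | (sigma ^+ 2 * t < energy us (e x))%R]%classic
   <= (2 ^+ size us * expR (- (3 / 8 * t)))%:E)%E.
Proof.
rewrite le_eqVlt => /predU1P[s0|s0] ous.
  (* For [sigma = 0], the choice [tau = k = 1] bounds the mean of the exponential of half the energy
     by 1; as the exponential of [z] is at least [1 + z], the energy vanishes almost surely. *)
  have := @integral_expR_energy_le0 1 1 us ltr01.
  rewrite expr1n invr1 subrr -s0 expr0n mul0r => /(_ erefl ous).
  rewrite expr1n => int_le1.
  suff -> : P [set x | (0 * t < energy us (e x))%R]%classic = 0%E.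
    by rewrite lee_fin mulr_ge0 ?expR_ge0 ?exprn_ge0.
  have mE : measurable_fun setT (fun x => energy us (e x)) by exact: measurable_energy.
  have mE2 : measurable_fun setT (fun x => expR (1 * energy us (e x) / 2) - 1).
    apply: measurable_funB => //; apply: measurableT_comp => //.
    by apply: measurable_funM => //; apply: measurable_funM.
  have ge1 x : energy us (e x) / 2 <= expR (1 * energy us (e x) / 2) - 1.
    by rewrite mul1r lerBrDl; exact: expR_ge1Dx.
  have ge0 x : 0 <= expR (1 * energy us (e x) / 2) - 1.
    by apply: le_trans (ge1 x); rewrite divr_ge0 ?energy_ge0.
  have int_half : (\int[P]_x (energy us (e x) / 2)%:E = 0)%E.
    apply/eqP; rewrite eq_le; apply/andP; split; last first.
      by apply: integral_ge0 => x _; rewrite lee_fin divr_ge0 ?energy_ge0.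
    apply: (@le_trans _ _ (\int[P]_x (expR (1 * energy us (e x) / 2) - 1)%:E)%E).
      apply: ge0_le_integral => //.
      - by move=> x _; rewrite lee_fin divr_ge0 ?energy_ge0.
      - by apply/measurable_EFinP; apply: measurable_funM.
      - exact/measurable_EFinP.
      - by move=> x _; rewrite lee_fin.
    rewrite -(@leeD2lE _ 1%E)// adde0; apply: le_trans int_le1.
    have int1 : (\int[P]_x 1%:E = 1)%E by rewrite integral_cst// mul1e; exact: probability_setT.
    rewrite -{1}int1 -ge0_integralD//; last 2 first.
    - by move=> x _; rewrite lee_fin.
    - exact/measurable_EFinP.
    by under eq_integral => x _ do rewrite -EFinD addrCA subrr addr0.
  have ae0 : ae_eq P setT (fun x => (energy us (e x) / 2)%:E) (cst 0%E).
    apply/(ae_eq_integral_abs P measurableT).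
      by apply/measurable_EFinP; apply: measurable_funM.
    rewrite -[RHS]int_half; apply: eq_integral => x _.
    by rewrite gee0_abs// lee_fin divr_ge0 ?energy_ge0.
  have [N [mN PN0 NE]] := ae0.
  apply/eqP; rewrite -measure_le0 -PN0 le_measure ?inE//.
    exact: measurable_energy_gt.
  move=> x /= ex; apply: NE => /= /(_ Logic.I) [] /eqP.
  by rewrite mulf_eq0 invr_eq0 pnatr_eq0 orbF gt_eqF// -(mul0r t).
pose tau := Num.sqrt (3 / 4) / sigma.
have tauE : sigma ^+ 2 * tau ^+ 2 = 3 / 4.
  by rewrite /tau expr_div_n sqr_sqrtr ?divr_ge0// mulrC divfK// expf_neq0// gt_eqF.
have := @integral_expR_energy_le0 tau 2 us (ltr0Sn _ 1).
rewrite tauE.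
have -> : 1 - 2 ^- 2 = 3 / 4 :> R by field.
move=> /(_ erefl ous) int_le.
set A := [set x | _]%classic.
have mA : measurable A by exact: measurable_energy_gt.
have mF : measurable_fun setT (fun x => expR (tau ^+ 2 * energy us (e x) / 2)).
  apply: measurableT_comp => //; apply: measurable_funM => //.
  by apply: measurable_funM => //; exact: measurable_energy.
(* Markov: the indicator of [A] is at most [expR (- (3 / 8 * t))] times the exponential integrated
   above. *)
rewrite mulrC EFinM.
apply: le_trans (lee_wpmul2l _ int_le); last by rewrite lee_fin expR_ge0.
rewrite -ge0_integralZl_EFin ?expR_ge0//; last first.
  exact/measurable_EFinP.
rewrite -(setIT A) -(integral_indic P measurableT mA).
apply: ge0_le_integral => //.
- by apply/measurable_EFinP; apply: measurable_indic.
- by apply: measurable_funeM; apply/measurable_EFinP.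
move=> x _; rewrite -EFinM lee_fin -expRD indicE.
have [|_] := boolP (x \in A); last by rewrite expR_ge0.
rewrite inE /A /= => xA; rewrite -[leLHS]expR0 ler_expR.
have : tau ^+ 2 * (sigma ^+ 2 * t) <= tau ^+ 2 * energy us (e x).
  by rewrite ler_wpM2l ?sqr_ge0// ltW.
rewrite mulrA (mulrC (tau ^+ 2) (sigma ^+ 2)) tauE; lra.
Qed.
End noise.

(** * Orthonormal expansions *)

Section spanned.
Context {R : realType} {n : nat}.
Implicit Types (u v w : 'cV[R]_n) (us ws : seq 'cV[R]_n).

Lemma dot_suml (I : Type) (s : seq I) (Q : pred I) (F : I -> 'cV[R]_n) w :
  dot (\sum_(i <- s | Q i) F i) w = \sum_(i <- s | Q i) dot (F i) w.
Proof.
by elim/big_rec2: _ => [|i a b _ <-]; rewrite ?dot0l ?dotDl.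
Qed.

Definition expansion us w : 'cV[R]_n := \sum_(u <- us) dot u w *: u.

(** For orthonormal [us] the expansion is the projection on their span, whose fixed points are that
    span; the equation gives Parseval's identity directly. *)
Definition spanned us w : Prop := expansion us w = w.

Lemma spannedD us v w : spanned us v -> spanned us w -> spanned us (v + w).
Proof.
rewrite /spanned => vE wE; rewrite -[in RHS]vE -[in RHS]wE -big_split.
by apply: eq_bigr => u _; rewrite dotDr scalerDl.
Qed.

Lemma spannedZ us (a : R) w : spanned us w -> spanned us (a *: w).
Proof.
rewrite /spanned => wE; rewrite -[in RHS]wE scaler_sumr.
by apply: eq_bigr => u _; rewrite dotZr scalerA.
Qed.

Lemma spanned0 us : spanned us 0.
Proof. by apply: big1 => u _; rewrite dotC dot0l scale0r. Qed.

Lemma spanned_sum us (I : Type) (s : seq I) (Q : pred I) (F : I -> 'cV[R]_n) :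
  (forall i, Q i -> spanned us (F i)) -> spanned us (\sum_(i <- s | Q i) F i).
Proof.
move=> sF; elim/big_ind: _ => //; [exact: spanned0|exact: spannedD].
Qed.

Lemma dot_spanned us w v : spanned us w ->
  dot w v = \sum_(u <- us) dot u w * dot u v.
Proof.
by move=> {1}<-; rewrite dot_suml; apply: eq_bigr => u _; rewrite dotZl.
Qed.

Lemma dot_expansion us w v : orthonormal us -> v \in us ->
  dot (expansion us w) v = dot v w.
Proof.
rewrite dot_suml.
elim: us => // u us IH /orthonormal_cons[u1 u0 ous].
rewrite inE big_cons => /predU1P[->|vus].
  rewrite big1_seq ?addr0; first by rewrite dotZl u1 mulr1.
  by move=> x /u0 x0; rewrite dotZl (dotC x u) x0 mulr0.
by rewrite IH// dotZl (u0 v vus) mulr0 add0r.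
Qed.

Lemma dot_eq0 u : (dot u u == 0) = (u == 0).
Proof.
apply/eqP/eqP => [|->]; last by rewrite dot0l.
move=> /psumr_eq0P u0; apply/matrixP => i j; rewrite ord1 mxE.
have : u i ord0 * u i ord0 = 0 by apply: u0 => // k _; rewrite -expr2 sqr_ge0.
by move/eqP; rewrite mulf_eq0 orbb => /eqP.
Qed.

Lemma dot_ge0 u : 0 <= dot u u.
Proof. by apply: sumr_ge0 => i _; rewrite -expr2 sqr_ge0. Qed.

(** Each vector adds its normalised residual, or nothing when the residual is zero, so the family
    never outgrows the list. *)
Lemma gram_schmidt ws : exists us, [/\ orthonormal us,
  (size us <= size ws)%N & forall w, w \in ws -> spanned us w].
Proof.
elim: ws => [|w ws [us [ous sus sp]]]; first by exists [::].
pose r := w - expansion us w.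
have [r0|rN0] := eqVneq r 0.
  exists us; split=> //; first exact: leqW.
  move=> v; rewrite inE => /predU1P[->|/sp//].
  by apply/esym/eqP; rewrite -subr_eq0; apply/eqP.
have r_us v : v \in us -> dot r v = 0.
  move=> vus; rewrite /r dotDl -scaleN1r dotZl dot_expansion// dotC.
  by rewrite mulN1r subrr.
pose s := Num.sqrt (dot r r).
have rr0 : dot r r != 0 by rewrite dot_eq0.
have s2 : s ^+ 2 = dot r r by rewrite sqr_sqrtr ?dot_ge0.
have s0 : s != 0 by rewrite -sqrf_eq0 s2.
(* Hence adjoining [r] leaves the expansions of vectors already spanned unchanged. *)
have r_sp v : spanned us v -> dot r v = 0.
  move=> vE; rewrite dotC (dot_spanned _ vE) big1_seq// => u uus.
  by rewrite (dotC u r) r_us// mulr0.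
exists (s^-1 *: r :: us); split.
- move: ous; rewrite /orthonormal /= => /andP[-> ->]; rewrite !andbT.
  rewrite dotZl dotZr mulrA -invfM -expr2 s2 mulVf// eqxx/=.
  by apply/allP => v /r_us rv; rewrite dotZl rv mulr0.
- by rewrite ltnS.
move=> v; rewrite inE /spanned /expansion big_cons -/(expansion us v).
move=> /predU1P[->|vws]; last first.
  by rewrite dotZl r_sp ?mulr0 ?scale0r ?add0r; exact: sp.
have rw : dot r w = dot r r.
  have wE : w = r + expansion us w by rewrite subrK.
  rewrite [in LHS]wE dotDr (r_sp (expansion us w)) ?addr0//.
  rewrite /spanned; apply: eq_big_seq => u uus.
  by rewrite (dotC u (expansion us w)) dot_expansion.
rewrite dotZl rw scalerA mulrAC -invfM -expr2 s2 mulVf// scale1r.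
by rewrite subrK.
Qed.

(** AM-GM in each coordinate along [us]; only the part of [v] inside the span is charged. *)
Lemma dot_le_energy us w v (b : R) : 0 < b -> spanned us w ->
  2 * dot w v <= b * dot w w + b^-1 * energy us v.
Proof.
move=> b0 sw; rewrite !(dot_spanned _ sw) /energy !mulr_sumr -big_split/=.
apply: ler_sum => u _; set x := dot u w; set z := dot u v.
rewrite -subr_ge0.
have -> : b * (x * x) + b^-1 * z ^+ 2 - 2 * (x * z) = b * (x - b^-1 * z) ^+ 2.
  by field; rewrite gt_eqF.
by rewrite mulr_ge0 ?sqr_ge0// ltW.
Qed.

(** Covers [a = 0], where the weights of the AM-GM step degenerate. *)
Lemma dot_energy0 us w v : spanned us w -> energy us v <= 0 -> dot w v = 0.
Proof.
move=> sw en0; rewrite (dot_spanned _ sw) big1_seq// => u uus.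
have : energy us v == 0 by rewrite eq_le en0 energy_ge0.
rewrite psumr_eq0 => [/allP/(_ _ uus)|i _]; last exact: sqr_ge0.
by rewrite sqrf_eq0 => /eqP ->; rewrite mulr0.
Qed.

End spanned.

(** * The oracle inequality *)

Section deterministic.
Context {R : realType} {n : nat}.
Implicit Types (f e v w : 'cV[R]_n) (us : seq 'cV[R]_n).

Lemma sqnorm_dot v : sqnorm v = dot v v.
Proof. by apply: eq_bigr => i _; rewrite expr2. Qed.

Lemma sqnormB v e : sqnorm (v - e) = sqnorm v - 2 * dot v e + sqnorm e.
Proof.
rewrite !sqnorm_dot -scaleN1r !(dotDl, dotDr, dotZl, dotZr) (dotC e v); ring.
Qed.

(** Here [v] and [w] stand for the residuals of estimator and target against the mean, [e] for the
    noise and [s] for the variance factor. The target has its own family [us0], whose energy bound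
    carries no complexity term. *)
Lemma penalized_oracle_inequality us0 us v w e (s lambda a c c' L : R) :
  spanned us0 w -> spanned us v ->
  sqnorm (v - e) + lambda * c <= sqnorm (w - e) + lambda * c' ->
  energy us e <= s * (74 / 10 * c + 10 / 3 * L) ->
  energy us0 e <= s * (10 / 3 * L) ->
  0 <= s -> 0 <= c -> 0 <= c' -> 0 <= L ->
  74 / 10 * s < lambda -> 74 / 10 * s / (lambda - 74 / 10 * s) <= a ->
  sqnorm v <= (1 + a) ^+ 2 * sqnorm w + (1 + a) * lambda * c'
              + s * (10 + 5 * a + 7 * a^-1) * L.
Proof.
move=> sw sv basic env enw s0 c0 c'0 L0 sl sa.
have l0 : 0 < lambda by lra.
have d0 : 0 < lambda - 74 / 10 * s by rewrite subr_gt0.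
have a_ge0 : 0 <= a by apply: le_trans sa; apply: divr_ge0; lra.
have {sa} sa : 74 / 10 * s * (1 + a) <= a * lambda.
  by move: sa; rewrite ler_pdivrMr// => sa; lra.
have {basic} basic : sqnorm v <= sqnorm w + (2 * dot v e - 2 * dot w e)
    + lambda * (c' - c) by move: basic; rewrite !sqnormB; lra.
have H0 : 0 <= sqnorm v by rewrite sqnorm_dot dot_ge0.
have B0 : 0 <= sqnorm w by rewrite sqnorm_dot dot_ge0.
(* The constraint on [a] then forces [s = 0], so both energies and both cross terms vanish. *)
have [a0|aN0] := eqVneq a 0.
  have s_eq0 : s = 0 by move: sa; rewrite a0 mul0r addr0 mulr1 => sa; lra.
  move: env enw; rewrite s_eq0 !mul0r => env enw.
  rewrite (dot_energy0 sv env) (dot_energy0 sw enw) in basic.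
  have lc := mulr_ge0 (ltW l0) c0.
  by rewrite a0; lra.
have a0 : 0 < a by rewrite lt_neqAle eq_sym aN0.
have a1 : 0 < 1 + a by lra.
(* AM-GM with weight [a / (1 + a)] for the estimator and [a] for the target. *)
have b0 : 0 < a / (1 + a) by rewrite divr_gt0.
have hv := dot_le_energy e b0 sv; rewrite invf_div -sqnorm_dot in hv.
have sNw : spanned us0 (- w) by rewrite -scaleN1r; exact: spannedZ.
have hw := dot_le_energy e a0 sNw.
rewrite -scaleN1r !dotZl !dotZr !mulN1r opprK mulrN -sqnorm_dot in hw.
have {hv} hv : 2 * dot v e <= a / (1 + a) * sqnorm v +
    (1 + a) / a * (s * (74 / 10 * c + 10 / 3 * L)).
  by apply: le_trans hv _; rewrite lerD2l ler_wpM2l// divr_ge0// ltW.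
have {hw} hw : - (2 * dot w e) <= a * sqnorm w + a^-1 * (s * (10 / 3 * L)).
  by apply: le_trans hw _; rewrite lerD2l ler_wpM2l// invr_ge0.
have {basic hv hw} key : sqnorm v / (1 + a) <=
   (1 + a) * sqnorm w + (1 + a) / a * (s * (74 / 10 * c + 10 / 3 * L))
   + a^-1 * (s * (10 / 3 * L)) + lambda * (c' - c).
  have -> : sqnorm v / (1 + a) = sqnorm v - a / (1 + a) * sqnorm v by field; rewrite gt_eqF.
  lra.
(* The lower bound on [a] is exactly what lets the penalty of the estimator absorb the complexity
   part of its noise energy. *)
have cs : (1 + a) / a * (s * (74 / 10 * c)) <= lambda * c.
  have -> : (1 + a) / a * (s * (74 / 10 * c)) = 74 / 10 * s * (1 + a) / a * c by field.
  by rewrite ler_wpM2r// ler_pdivrMr// mulrC (mulrC lambda); lra.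
have {key cs} key : sqnorm v / (1 + a) <= (1 + a) * sqnorm w + lambda * c'
    + ((1 + a) / a + a^-1) * (s * (10 / 3 * L)).
  lra.
move: key; rewrite ler_pdivrMr// => key; apply: le_trans key _.
(* The noise coefficient obtained is [10 + 10 / 3 * a + 20 / 3 * a^-1]; [D] is the slack left by
   rounding up to [5] and [7]. *)
rewrite -subr_ge0.
set D := (X in 0 <= X).
have -> : D = s * L * (5 / 3 * a + 3^-1 * a^-1).
  by rewrite /D; field.
by rewrite mulr_ge0 ?mulr_ge0// addr_ge0// mulr_ge0// ?invr_ge0 ?ler0n ?divr_ge0.
Qed.
End deterministic.

(** * Union bound over the sets [F] and conclusion *)

Lemma measure_bigsetU_le d (T : measurableType d) (R : realType)
  (mu : {measure set T -> \bar R}) (I : Type) (s : seq I) (Q : pred I)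
  (B : I -> set T) :
  (forall i, Q i -> measurable (B i)) ->
  (mu (\big[setU/set0]_(i <- s | Q i) B i) <= \sum_(i <- s | Q i) mu (B i))%E.
Proof.
move=> mB.
suff [] : measurable (\big[setU/set0]_(i <- s | Q i) B i) /\
  (mu (\big[setU/set0]_(i <- s | Q i) B i) <= \sum_(i <- s | Q i) mu (B i))%E by [].
elim/big_rec2: _ => [|i x A Qi [mA le]]; first by rewrite measure0.
split; first by apply: measurableU => //; exact: mB.
by apply: le_trans (measureU2 mu (mB _ Qi) mA) _; rewrite leeD2l.
Qed.

(** The full set contains every support, so the minimum runs over a nonempty family and the default
    [+oo] is harmless. *)
Lemma ccomp_attained (R : realType) p (cl : {set 'I_p} -> \bar R) (beta : 'cV[R]_p) :
  exists2 F : {set 'I_p}, supp beta \subset F & ccomp cl beta = ccF cl F.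
Proof.
have [||F sF E] := @eq_bigmin _ _ _ +oo%E finset.setT (fun F => supp beta \subset F) (ccF cl).
- exact: finset.subsetT.
- by move=> F _; exact: leey.
by exists F.
Qed.

Lemma spanned_mulmx (R : realType) n p (X : 'M[R]_(n, p)) (F : {set 'I_p})
  (us : seq 'cV[R]_n) (beta : 'cV[R]_p) :
  (forall j, j \in F -> spanned us (col j X)) -> supp beta \subset F ->
  spanned us (X *m beta).
Proof.
move=> sX /fintype.subsetP sF.
have -> : X *m beta = \sum_j beta j ord0 *: col j X.
  apply/matrixP => i k; rewrite ord1 !mxE summxE.
  by apply: eq_bigr => j _; rewrite !mxE mulrC.
apply: spanned_sum => j _; have [->|b0] := eqVneq (beta j ord0) 0.
  by rewrite scale0r; exact: spanned0.
by apply/spannedZ/sX/sF; rewrite inE.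
Qed.

(* Here [3/8 * 74/10 = 111/40], and [9/20] bounds [2 e^(-111/40)]: a nonempty
   [F] pays at least one such factor, so that the total failure probability is
   at most [2/3 * (1 + 9/20) * eta < eta]. *)
Lemma tail_weight_le (R : realType) (k : nat) (c eta : R) : 0 < eta < 1 -> 0 <= c ->
  2 ^+ k.+2 * expR (- (3 / 8 * (74 / 10 * (k%:R + c) + 10 / 3 * ln (6 / eta))))
  <= 2 / 3 * (9 / 20) ^+ (k != 0%N) * expR (- c * ln 2) * eta.
Proof.
move=> /andP[eta0 eta1] c0.
set L := ln _.
have L0 : 0 <= L by apply: ln_ge0; rewrite ler_pdivlMr//; lra.
have eL : expR (- L) = eta / 6.
  by rewrite expRN lnK ?posrE ?divr_gt0// invf_div.
have ln2 : ln 2 <= 1 :> R.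
  by have := @le_ln1Dx R 1; apply; lra.
(* This asks for [expR (111 / 40)] to be at least [40 / 9], which a quadratic lower bound gives. *)
have e4 : 2 * expR (- (111 / 40)) <= 9 / 20 :> R.
  rewrite expRN ler_pdivrMr ?expR_gt0//.
  have h : 0 <= 111 / 40 :> R by lra.
  have := expR_ge1Dxn 1 h; rewrite (_ : 2`!%:R = 2)//; lra.
have ek : 2 ^+ k * expR (- (111 / 40) * k%:R) <= (9 / 20) ^+ (k != 0%N) :> R.
  rewrite expRM_natr -exprMn; case: k => //= k.
  rewrite expr1 exprS; apply: le_trans (e4); rewrite ler_piMr ?mulr_ge0 ?expR_ge0//.
  by rewrite exprn_ile1 ?mulr_ge0 ?expR_ge0//; apply: le_trans e4 _; lra.
have -> : 2 ^+ k.+2 * expR (- (3 / 8 * (74 / 10 * (k%:R + c) + 10 / 3 * L))) =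
  4 * (2 ^+ k * expR (- (111 / 40) * k%:R)) * expR (- (111 / 40) * c) * expR (- (5 / 4 * L)).
  set E1 := expR (- (111 / 40) * k%:R); set E2 := expR (- (111 / 40) * c).
  set E3 := expR (- (5 / 4 * L)).
  have -> : 4 * (2 ^+ k * E1) * E2 * E3 = 2 ^+ k.+2 * (E1 * E2 * E3) by rewrite !exprS; ring.
  by rewrite /E1 /E2 /E3 -!expRD; congr (_ * expR _); field.
(* The factor 4 pays for the two extra dimensions. Weakening [5 / 4 * L] to [L] leaves [eta / 6],
   whence [2 / 3]; weakening [111 / 40] to [ln 2] leaves the coding weight. *)
apply: (@le_trans _ _ (4 * (9 / 20) ^+ (k != 0%N) * expR (- c * ln 2) * expR (- L))).
  apply: ler_pM => //; rewrite ?mulr_ge0 ?expR_ge0 ?exprn_ge0//; last first.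
    by rewrite ler_expR; lra.
  apply: ler_pM => //; rewrite ?mulr_ge0 ?expR_ge0 ?exprn_ge0//; last first.
    rewrite ler_expR !mulNr lerN2 mulrC ler_wpM2r//; lra.
  by rewrite ler_wpM2l.
by rewrite eL le_eqVlt; apply/orP; left; apply/eqP; field.
Qed.

Theorem theorem3 (d : measure_display) (T : measurableType d) (R : realType)
  (P : probability T R) (n p : nat) (X : 'M[R]_(n, p))
  (y : 'I_n -> T -> R) (sigma : R)
  (cl : {set 'I_p} -> \bar R)
  (betahat : R -> T -> 'cV[R]_p)
  (betabar : 'cV[R]_p) (eta : R) :
  0 <= sigma ->
  (forall i, measurable_fun setT (y i)) ->
  (forall i, P.-integrable setT (EFin \o y i)) ->
  mutually_independent P y ->
  (forall i (t : R),
      (\int[P]_x (expR (t * (y i x - mean P (y i))))%:E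
         <= (expR (sigma ^+ 2 * t ^+ 2 / 2))%:E)%E) ->
  coding_length cl ->
  (forall lambda, 0 < lambda -> forall w (beta : 'cV[R]_p),
      ((sqnorm (X *m betahat lambda w - \col_i y i w))%:E
         + lambda%:E * ccomp cl (betahat lambda w)
       <= (sqnorm (X *m beta - \col_i y i w))%:E
         + lambda%:E * ccomp cl beta)%E) ->
  0 < eta < 1 ->
  exists A : set T, [/\ measurable A, ((1 - eta)%:E < P A)%E &
    forall w, A w ->
    forall lambda a, 74 / 10 * sigma ^+ 2 < lambda ->
      74 / 10 * sigma ^+ 2 / (lambda - 74 / 10 * sigma ^+ 2) <= a ->
      ((sqnorm (X *m betahat lambda w - \col_i mean P (y i)))%:E
       <= ((1 + a) ^+ 2 * sqnorm (X *m betabar - \col_i mean P (y i)))%:E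
          + ((1 + a) * lambda)%:E * ccomp cl betabar
          + (sigma ^+ 2 * (10 + 5 * a + 7 * a^-1) * ln (6 / eta))%:E)%E].
Proof.
move=> s0 my iy ind sg [cl0 cl_ge0 clsum] hbeta eta01.
have /andP[eta0 eta1] := eta01.
pose f : 'cV[R]_n := \col_i mean P (y i).
pose e x : 'cV[R]_n := \col_i (y i x - mean P (y i)).
pose L := ln (6 / eta).
have L0 : 0 <= L by apply: ln_ge0; rewrite ler_pdivlMr//; lra.
have me i : measurable_fun setT (fun x => e x i ord0).
  rewrite (_ : (fun x => _) = fun x => y i x - mean P (y i)); last first.
    by apply/funext => x; rewrite mxE.
  exact: measurable_funB.
have sge v := subgaussian_dot v ind my sg.
have /choice[us usP] : forall F : {set 'I_p}, exists us : seq 'cV[R]_n,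
    [/\ orthonormal us, (size us <= #|F|.+2)%N, spanned us f,
        spanned us (X *m betabar) & forall j, j \in F -> spanned us (col j X)].
  move=> F.
  have [us [ous sus sp]] := gram_schmidt [:: f, X *m betabar & [seq col j X | j <- enum F]].
  exists us; split=> //.
  - by move: sus; rewrite /= size_map -cardE.
  - by apply: sp; rewrite !inE eqxx.
  - by apply: sp; rewrite !inE eqxx orbT.
  - move=> j jF; apply: sp; rewrite !inE; apply/orP; right; apply/orP; right.
    by apply/mapP; exists j; rewrite ?mem_enum.
pose t (F : {set 'I_p}) := 74 / 10 * (#|F|%:R + fine (cl F)) + 10 / 3 * L.
pose B F := [set x | sigma ^+ 2 * t F < energy (us F) (e x)]%classic.
have mB F : measurable (B F) by apply: measurable_energy_gt.
(* The bad event involves neither [betahat], [lambda] nor [a], so one event serves all of them.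
   Infinite lengths are excluded because [fine] would send them to 0 in [t]. *)
pose U := \big[setU/set0]_(F | cl F \is a fin_num) B F.
have mU : measurable U by exact: bigsetU_measurable.
have PB F : cl F \is a fin_num ->
    (P (B F) <= (2 / 3 * (9 / 20) ^+ (F != finset.set0) * pow2neg (cl F) * eta)%:E)%E.
  move=> clF; have [ous sus _ _ _] := usP F.
  apply: le_trans (energy_gt_le me sge (t F) s0 ous) _; rewrite lee_fin.
  have c0 : 0 <= fine (cl F) by rewrite fine_ge0.
  have := tail_weight_le #|F| eta01 c0.
  have -> : expR (- fine (cl F) * ln 2) = pow2neg (cl F).
    by rewrite -[in RHS](fineK clF).
  rewrite -lt0n card_gt0 => le; apply: le_trans le.
  by rewrite ler_wpM2r ?expR_ge0// ler_weXn2l// ler1n.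
have PU : (P U < eta%:E)%E.
  apply: le_lt_trans (measure_bigsetU_le P _ (fun F _ => mB F)) _.
  apply: le_lt_trans (lee_sum _ PB) _; rewrite sumEFin lte_fin.
  have pow0 F : 0 <= pow2neg (cl F) by case: (cl F) => //= r; rewrite expR_ge0.
  apply: (@le_lt_trans _ _ (\sum_(F : {set 'I_p})
      2 / 3 * (9 / 20) ^+ (F != finset.set0) * pow2neg (cl F) * eta)).
    rewrite [leLHS]big_mkcond; apply: ler_sum => F _.
    by case: ifP => // _; rewrite !mulr_ge0 ?exprn_ge0// ltW.
  (* The empty set has weight 1 and the others sum to at most [9 / 20], for a total of
     [29 / 30 * eta]. *)
  rewrite (bigD1 finset.set0)//= eqxx cl0 /= oppr0 mul0r expR0.
  under eq_bigr => F F0 do rewrite F0 expr1 mulrAC.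
  by rewrite -mulr_sumr; nra.
exists (~` U)%classic; split; first exact: measurableC.
  have PUf : P U \is a fin_num by exact: fin_num_measure.
  by rewrite probability_setC// -(fineK PUf) -EFinB lte_fin ltrD2l ltrN2 -lte_fin fineK.
move=> w wU lambda a sl sa.
have l0 : 0 < lambda by apply: le_lt_trans sl; rewrite mulr_ge0// sqr_ge0.
have en F : cl F \is a fin_num -> energy (us F) (e w) <= sigma ^+ 2 * t F.
  move=> clF; rewrite leNgt; apply/negP => enF; apply: wU.
  by rewrite /U (bigD1 F)//; left.
have sub z : z - \col_i y i w = z - f - e w.
  rewrite -addrA -opprD; congr (_ - _); apply/matrixP => i j.
  by rewrite !mxE addrC subrK.
have ccF0 F : (0 <= ccF cl F)%E by rewrite adde_ge0.
have a_ge0 : 0 <= a.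
  by apply: le_trans sa; have := sqr_ge0 sigma; move=> ?; apply: divr_ge0; lra.
have basic := hbeta lambda l0 w betabar.
have c'0 : (0 <= ccomp cl betabar)%E.
  by have [F _ ->] := ccomp_attained cl betabar.
(* If the target has infinite complexity, the right-hand side is [+oo]. *)
move: basic c'0; case: (ccomp cl betabar) => [c'| |//]; last first.
  by move=> _ _; rewrite gt0_muley ?lte_fin ?mulr_gt0// ?ltr_pwDl// addey// addye// leey.
rewrite lee_fin => basic c'0.
have [F sF cE] := ccomp_attained cl (betahat lambda w).
(* An infinite length at the minimizing [F] would contradict optimality against a target of finite
   cost. *)
move: basic; rewrite cE /ccF; case clE : (cl F) => [r| |]; last 2 first.
- by rewrite addey// gt0_muley ?lte_fin// addey// -EFinM -EFinD leye_eq.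
- by have := cl_ge0 F; rewrite clE.
rewrite -EFinD -!EFinM -!EFinD !lee_fin !sub => basic.
have [_ _ sf sbar scol] := usP F; have [_ _ sf0 sbar0 _] := usP finset.set0.
have r0 : 0 <= r by have := cl_ge0 F; rewrite clE lee_fin.
have spB us' (u v : 'cV[R]_n) : spanned us' u -> spanned us' v -> spanned us' (u - v).
  by move=> su sv; rewrite -scaleN1r; apply: spannedD => //; exact: spannedZ.
apply: (@penalized_oracle_inequality _ _ (us finset.set0) (us F) _ _ (e w)
  _ _ _ (#|F|%:R + r)) => //.
- exact: spB.
- by apply: spB => //; exact: (spanned_mulmx scol).
- by have := en F; rewrite /t clE; apply.
(* The empty set has zero complexity, so its level [t] reduces to [10 / 3 * L]. *)
- have := en finset.set0; rewrite /t cl0 cards0 addr0 mulr0 add0r; apply.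
  by [].
- exact: sqr_ge0.
- by rewrite addr_ge0.
Qed.
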